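(* Let $G$ be a finite bipartite graph with maximum degree $\Delta(G)$, and let $m \geq 1$ be an integer. Let $M$ be a set of edges of the Cartesian product $G \square K_{2m}$ such that the distance between any two distinct edges of $M$ is at least $2$, and let each edge of $M$ be assigned (prescribed) a color from $\{1,2,\dots,\Delta(G)+2m-1\}$. Then this precoloring is extendable, i.e. there is a proper edge coloring of $G \square K_{2m}$ using at most $\chi'(G \square K_{2m})$ colors in which every edge of $M$ receives its prescribed color; in fact such a proper edge coloring exists using only the colors $\{1,\dots,\Delta(G)+2m-1\}$.
   Context: The Cartesian product $G_1 \square G_2$ has vertex set $V(G_1)\times V(G_2)$, with $(u_1,u_2)$ adjacent to $(v_1,v_2)$ iff either $u_1=v_1$ and $u_2v_2\in E(G_2)$, or $u_2=v_2$ and $u_1v_1\in E(G_1)$. The distance $d(x,y)$ between vertices is the length of a shortest $x$–$y$ path, and the distance between edges $e=xy$ and $f=zw$ is $\min\{d(x,z),d(x,w),d(y,z),d(y,w)\}$; thus a set of edges with pairwise distance at least $2$ is an induced matching. $\chi'$ denotes the chromatic index. A precoloring (a proper coloring of a subset $E_0$ of edges) is called extendable if there is a proper edge coloring of the whole graph with $\chi'$ colors agreeing with the prescribed colors on $E_0$. *)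

(* Defs.v *)
From mathcomp Require Import all_boot.

Set Implicit Arguments.
Unset Strict Implicit.
Unset Printing Implicit Defensive.

Record sgraph := SGraph {
  vertex :> finType;
  adj : rel vertex;
  adj_sym : symmetric adj;
  adj_irrefl : irreflexive adj }.

Definition complete_rel n : rel 'I_n := fun i j => i != j.

Fact complete_rel_sym n : symmetric (@complete_rel n).
Proof. by move=> i j; rewrite /complete_rel eq_sym. Qed.

Fact complete_rel_irrefl n : irreflexive (@complete_rel n).
Proof. by move=> i; rewrite /complete_rel eqxx. Qed.

Definition complete_graph n : sgraph :=
  SGraph (@complete_rel_sym n) (@complete_rel_irrefl n).

Definition cart_rel (G1 G2 : sgraph) : rel (G1 * G2) := fun u v =>
  (u.1 == v.1) && adj u.2 v.2 || (u.2 == v.2) && adj u.1 v.1.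

Fact cart_rel_sym (G1 G2 : sgraph) : symmetric (@cart_rel G1 G2).
Proof.
move=> u v; rewrite /cart_rel [u.1 == _]eq_sym [u.2 == _]eq_sym.
by rewrite [adj u.1 _]adj_sym [adj u.2 _]adj_sym.
Qed.

Fact cart_rel_irrefl (G1 G2 : sgraph) : irreflexive (@cart_rel G1 G2).
Proof. by move=> u; rewrite /cart_rel !adj_irrefl !andbF. Qed.

Definition cartesian_product (G1 G2 : sgraph) : sgraph :=
  SGraph (@cart_rel_sym G1 G2) (@cart_rel_irrefl G1 G2).

Section Graph.

Variable G : sgraph.

(* An edge xy is represented by the set of its two ends. *)
Definition edges : {set {set G}} :=
  [set [set p.1; p.2] | p in [pred p : G * G | adj p.1 p.2]].

Definition max_degree : nat := \max_(x : G) #|[set y | adj x y]|.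

Definition bipartite : Prop :=
  exists A : {set G}, forall x y : G, adj x y -> (x \in A) != (y \in A).

Definition walk (n : nat) (x y : G) : bool :=
  [exists p : n.-tuple G, path (@adj G) x p && (last x p == y)].

(* A shortest walk has fewer than #|G| edges (see [distP]), so the search can
   be bounded; [None] is the infinite distance. *)
Definition dist (x y : G) : option nat :=
  let d := find (fun n => walk n x y) (iota 0 #|G|) in
  if d < #|G| then Some d else None.

Definition mindist (a b : option nat) : option nat :=
  match a, b with
  | Some m, Some n => Some (minn m n)
  | Some m, None => Some m
  | None, _ => b
  end.

Definition edge_dist (e f : {set G}) : option nat :=
  \big[mindist/None]_(x in e) \big[mindist/None]_(y in f) dist x y.

Definition dist_geq (k : nat) (a : option nat) : bool :=
  if a is Some d then k <= d else true.

Definition proper_edge_coloring (c : {set G} -> nat) : bool :=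
  [forall e in edges, forall f in edges,
     (e != f) && (e :&: f != set0) ==> (c e != c f)].

Definition colors_within (k : nat) (c : {set G} -> nat) : bool :=
  [forall e in edges, 1 <= c e <= k].

Definition num_colors (c : {set G} -> nat) : nat :=
  size (undup [seq c e | e in edges]).

(* Finite functions into {0, ..., k} make this a boolean;
   [edge_colorableP] removes the encoding. *)
Definition edge_colorable (k : nat) : bool :=
  [exists c : {ffun {set G} -> 'I_k.+1},
     proper_edge_coloring (fun e => c e) && colors_within k (fun e => c e)].

Lemma edge_colorableP k :
  reflect (exists c, proper_edge_coloring c && colors_within k c)
          (edge_colorable k).
Proof.
apply: (iffP existsP) => [[c Hc]|[c /andP[/forall_inP Hp /forall_inP Hk]]].
  by exists (fun e => c e : nat).
pose c' : {ffun {set G} -> 'I_k.+1} := [ffun e => inord (c e)].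
have c'E e : e \in edges -> c' e = c e :> nat.
  by move=> /Hk /andP[_ le_k]; rewrite ffunE inordK.
exists c'; apply/andP; split; apply/forall_inP => e He; last first.
  by rewrite c'E //; apply: Hk.
apply/forall_inP => f Hf; rewrite !c'E //.
by move/forall_inP: (Hp e He); apply.
Qed.

Fact edge_colorable_ex : exists k, edge_colorable k.
Proof.
exists #|edges|; apply/edge_colorableP; exists (fun e => (index e (enum edges)).+1).
apply/andP; split; apply/forall_inP => e He; last first.
  by rewrite /= cardE index_mem mem_enum.
apply/forall_inP => f Hf; apply/implyP => /andP[ne_ef _].
apply: contra ne_ef; rewrite eqSS => /eqP /(congr1 (nth e (enum edges))).
by rewrite !nth_index ?mem_enum // => ->.
Qed.

Definition chromatic_index : nat := ex_minn edge_colorable_ex.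

(* The precoloring of E0 is [phi] restricted to E0. *)
Definition extends (E0 : {set {set G}}) (phi c : {set G} -> nat) : Prop :=
  {in E0, c =1 phi}.

Definition extendable (E0 : {set {set G}}) (phi : {set G} -> nat) : Prop :=
  exists c : {set G} -> nat,
    [/\ proper_edge_coloring c, num_colors c <= chromatic_index
      & extends E0 phi c].

Lemma walkP n x y :
  reflect (exists p, [/\ size p = n, path (@adj G) x p & last x p = y])
          (walk n x y).
Proof.
apply: (iffP existsP) => [[p /andP[Hp /eqP Hy]]|[p [Hs Hp Hy]]].
  by exists p; rewrite size_tuple.
by exists (Tuple (introT eqP Hs)); rewrite /= Hp Hy eqxx.
Qed.

Lemma walk_shorten n x y : walk n x y -> exists2 k, k < #|G| & walk k x y.
Proof.
case/walkP=> p [_ Hp <-]; case/shortenP: Hp => q Hq Uq _.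
exists (size q); last by apply/walkP; exists q.
by have := max_card (mem (x :: q)); rewrite (card_uniqP Uq).
Qed.

Lemma distP x y :
  match dist x y with
  | Some d => walk d x y /\ forall n, walk n x y -> d <= n
  | None => forall n, ~~ walk n x y
  end.
Proof.
rewrite /dist; set a := fun n => walk n x y.
have hasE : has a (iota 0 #|G|) = (find a (iota 0 #|G|) < #|G|).
  by rewrite has_find size_iota.
case: ifP => Hd.
  split; first by have := nth_find 0 (etrans hasE Hd); rewrite nth_iota.
  move=> n Hn; rewrite leqNgt; apply/negP => lt_n.
  have := before_find 0 lt_n; rewrite nth_iota ?add0n ?(ltn_trans lt_n) //.
  by rewrite /a Hn.
move=> n; apply/negP => /walk_shorten [k lt_k Hk].
have : has a (iota 0 #|G|) by apply/hasP; exists k; rewrite ?mem_iota.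
by rewrite hasE Hd.
Qed.

End Graph.

(* Main.v *)
Require Import Defs.
From mathcomp Require Import all_boot.
From mathcomp Require Import zify.

Set Implicit Arguments.
Unset Strict Implicit.
Unset Printing Implicit Defensive.

(** Any two vertices of a layer {x} x K_2m are at distance at most 1, so every
    layer meets at most one edge of M; let col x be the color of that edge.
    All levels G x {i} get the same coloring h: a horizontal edge of M imposes
    its color on its projection to G (at every level), and every other edge xy
    of G gets a color outside {col x, col y}.  The layer of x is then completed
    by a 1-factorization of K_2m using 2m - 1 of the colors that h misses at x,
    permuted so that a vertical edge of M at x gets its color.

    To find h, delete from G the projections of the horizontal edges of M. An
    edge xy has at least Delta + 2m - 3 colors left, which suffices for m > 1.
    If m = 1 and both x and y are touched by M, the edges of M there are both
    horizontal, so x and y have degree less than Delta in the remaining graph.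
    In all cases xy has at least max(d(x), d(y)) colors left, and the theorem
    of Borodin, Kostochka and Woodall (a refinement of Galvin's) applies. *)

(** * Hall's marriage theorem *)

(** Halmos-Vaughan induction on the size of [X]. If some nonempty proper subset [Q] is tight, [Q]
    and its complement are matched separately, the complement with the neighbors of [Q] removed.
    Otherwise every nonempty proper subset has a neighbor to spare, so one [x] may take any [y] in
    [R x]. *)
Lemma hall (T U : finType) (u0 : U) (R : T -> {set U}) (X : {set T}) :
  (forall Q : {set T}, Q \subset X -> #|Q| <= #|\bigcup_(x in Q) R x|) ->
  exists2 f : T -> U, {in X &, injective f} & {in X, forall x, f x \in R x}.
Proof.
have [n] := ubnP #|X|; elim: n => // n IHn in R X * => le_n hallX.
have [->|/set0Pn[x Xx]] := eqVneq X set0.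
  by exists (fun=> u0) => x; rewrite inE.
pose tight Q := [&& Q != set0, Q \proper X & #|\bigcup_(x in Q) R x| == #|Q|].
case: (pickP tight) => [Q /and3P[Q0 ltQ /eqP cardQ]|no_tight].
  have sQX := proper_sub ltQ.
  have [||f finj fR] := IHn R Q.
  - by apply: leq_trans (proper_card ltQ) _; rewrite -ltnS.
  - by move=> Q' sQ'; apply: hallX; apply: subset_trans sQX.
  pose B := \bigcup_(x in Q) R x.
  have [||g ginj gR] := IHn (fun x => R x :\: B) (X :\: Q).
  - rewrite cardsD (setIidPr sQX).
    by move: Q0; rewrite -card_gt0; have := subset_leq_card sQX; lia.
  - move=> Q' sQ'.
    have dis: [disjoint Q & Q'].
      rewrite disjoint_sym disjoints_subset; apply: subset_trans sQ' _.
      by apply/subsetP=> z; rewrite !inE => /andP[].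
    have := hallX (Q :|: Q').
    rewrite subUset sQX (subset_trans sQ' (subsetDl _ _)) => /(_ isT).
    rewrite -leq_card_setU in dis; move/eqP: dis => ->.
    have -> : \bigcup_(x0 in Q :|: Q') R x0 =
       B :|: \bigcup_(x0 in Q') (R x0 :\: B).
      apply/setP=> y; rewrite in_setU; apply/bigcupP/orP.
        case=> z; rewrite inE => zQ yz; case: (boolP (y \in B)) => yB; first by left.
        right; case/orP: zQ => zQ; first by case/bigcupP: yB; exists z.
        by apply/bigcupP; exists z; rewrite // inE yB.
      case=> [/bigcupP[z zQ yz]|/bigcupP[z zQ]]; first by exists z; rewrite // inE zQ.
      by rewrite inE => /andP[_ yz]; exists z; rewrite // inE zQ orbT.
    by rewrite cardsU -cardQ -/B; lia.
  exists (fun x => if x \in Q then f x else g x) => [y z Xy Xz|y Xy]; last first.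
    case: ifP => Qy; first exact: fR.
    by have := gR y; rewrite !inE Qy Xy => /(_ isT) /andP[].
  have gNB t : t \in X -> t \notin Q -> g t \notin B.
    by move=> Xt Qt; have := gR t; rewrite !inE Qt Xt => /(_ isT) /andP[].
  have fB t : t \in Q -> f t \in B.
    by move=> Qt; apply/bigcupP; exists t => //; apply: fR.
  case: ifPn => Qy; case: ifPn => Qz.
  - exact: finj.
  - by move=> eq_fg; have := gNB z Xz Qz; rewrite -eq_fg fB.
  - by move=> eq_fg; have := gNB y Xy Qy; rewrite eq_fg fB.
  - by apply: ginj; rewrite !inE ?Qy ?Qz.
have Rx : 0 < #|R x|.
  by have := hallX [set x]; rewrite sub1set Xx cards1 big_set1; apply.
have [y Rxy] := card_gt0P Rx.
have [||f finj fR] := IHn (fun z => R z :\ y) (X :\ x).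
- by have := cardsD1 x X; rewrite Xx; lia.
- move=> Q sQ; have [->|Q0] := eqVneq Q set0; first by rewrite cards0.
  have ltQ : Q \proper X by apply: sub_proper_trans sQ (properD1 Xx).
  have := no_tight Q; rewrite /tight Q0 ltQ /= => /negbT ne.
  have lt : #|Q| < #|\bigcup_(z in Q) R z|.
    by rewrite ltn_neqAle eq_sym ne hallX ?proper_sub.
  have -> : \bigcup_(z in Q) (R z :\ y) = (\bigcup_(z in Q) R z) :\ y.
    apply/setP=> t; rewrite !inE; apply/bigcupP/andP.
      by case=> z Qz; rewrite !inE => /andP[-> tz]; split=> //; apply/bigcupP; exists z.
    by case=> ty /bigcupP[z Qz tz]; exists z; rewrite // !inE ty.
  by move: lt; rewrite (cardsD1 y); case: (_ \in _); lia.
exists (fun z => if z == x then y else f z) => [z t Xz Xt|z Xz]; last first.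
  case: eqVneq => [->//|zx].
  by have := fR z; rewrite !inE zx Xz => /(_ isT) /andP[].
have fNy s : s \in X -> s != x -> f s != y.
  by move=> Xs sx; have := fR s; rewrite !inE sx Xs => /(_ isT) /andP[].
case: eqVneq => [->|zx]; case: eqVneq => [->//|tx].
- by move=> yf; have := fNy t Xt tx; rewrite -yf eqxx.
- by move=> fy; have := fNy z Xz zx; rewrite fy eqxx.
- by apply: finj; rewrite !inE ?zx ?tx.
Qed.

(** * Stable matchings and Galvin's list coloring of bipartite multigraphs *)

(** A bipartite multigraph is encoded by an edge type and two end maps, so parallel edges are
    allowed and the same notions serve both sides. *)
Definition star (E V : finType) (f : E -> V) (H : {set E}) (v : V) : {set E} :=
  [set e in H | f e == v].

(** Smaller ranks are preferred. In Galvin's orientation of the line graph these are the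
    out-neighbors of [e] at one of its ends. *)
Definition before (E V : finType) (f : E -> V) (p : E -> nat) (H : {set E}) (e : E) :
    {set E} :=
  [set d in star f H (f e) | p d < p e].

Definition ranks (E V : finType) (f : E -> V) (p : E -> nat) (H : {set E}) : Prop :=
  {in H &, forall d e, f d = f e -> p d = p e -> d = e}.

Lemma ranksS (E V : finType) (f : E -> V) p (H H' : {set E}) :
  H' \subset H -> ranks f p H -> ranks f p H'.
Proof. by move=> /subsetP sH rH d e /sH Hd /sH He; apply: rH. Qed.

Lemma starS (E V : finType) (f : E -> V) (H H' : {set E}) v :
  H' \subset H -> star f H' v \subset star f H v.
Proof.
by move=> /subsetP sH; apply/subsetP=> e; rewrite !inE => /andP[/sH-> ->].
Qed.

Lemma beforeS (E V : finType) (f : E -> V) p (H H' : {set E}) e :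
  H' \subset H -> before f p H' e \subset before f p H e.
Proof.
by move=> /subsetP sH; apply/subsetP=> d; rewrite !inE => /andP[/andP[/sH-> ->] ->].
Qed.

Section BipartiteMultigraph.

Variables (E V W : finType) (l : E -> V) (r : E -> W).

(** The stable matching theorem of Gale and Shapley, by induction on the number of edges; [K] is a
    kernel of the oriented line graph. *)
Lemma stable_matching (pl pr : E -> nat) (H : {set E}) :
  ranks l pl H -> ranks r pr H ->
  exists K : {set E},
    [/\ K \subset H, {in K &, injective l}, {in K &, injective r} &
       {in H, forall e, e \notin K ->
          exists2 d, d \in K & d \in before l pl H e :|: before r pr H e}].
Proof.
have [n] := ubnP #|H|; elim: n => // n IHn in H * => le_n rl rr.
(* If the favorite edges of the left ends do not form a matching, two of them
   compete at a right end, and the loser can be discarded. *)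
pose best e := (e \in H) && (before l pl H e == set0).
have bestinj d e : best d -> best e -> l d = l e -> d = e.
  case/andP=> Hd /eqP bd /andP[He /eqP be] lde; apply: rl => //.
  move/setP/(_ e): bd; move/setP/(_ d): be.
  by rewrite !inE Hd He lde eqxx /= => /negbT + /negbT; rewrite -!leqNgt; lia.
have bestP e : e \in H -> exists2 d, best d & (l d == l e) && (pl d <= pl e).
  move=> He.
  have P0 : (e \in H) && (l e == l e) by rewrite He eqxx.
  case: (@arg_minnP _ e (fun d => (d \in H) && (l d == l e)) pl P0) => d /andP[Hd /eqP ld] dmin.
  exists d; last by rewrite ld eqxx dmin // P0.
  rewrite /best Hd; apply/eqP/setP=> c; rewrite !inE; apply/negbTE/negP.
  by rewrite ld => /andP[Pc]; rewrite ltnNge dmin.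
case: (pickP [pred c : E * E | [&& best c.1, best c.2, r c.1 == r c.2 & pr c.1 < pr c.2]]).
  case=> d e /and4P[/= bd be /eqP rde ltde].
  have [Hd He] : d \in H /\ e \in H by case/andP: bd => ->; case/andP: be.
  have sH : H :\ e \subset H by apply: subsetDl.
  have [|||K [sK Kl Kr Kst]] := IHn (H :\ e).
  - by have := cardsD1 e H; rewrite He; lia.
  - exact: ranksS rl.
  - exact: ranksS rr.
  exists K; split=> // [|c Hc cK]; first exact: subset_trans sH.
  have [->{c Hc cK}|ce] := eqVneq c e; last first.
    have [|d' Kd'] := Kst c _ cK; first by rewrite !inE ce.
    by move=> /(subsetP (setUSS (beforeS _ _ _ sH) (beforeS _ _ _ sH))); exists d'.
  (* The discarded [e] is dominated by [d] or by the edge that dominates [d]. The latter meets [d]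
     at the right end, since [d] is first at its left end. *)
  have [Kd|dK] := boolP (d \in K).
    by exists d => //; rewrite !inE Hd rde eqxx ltde orbT.
  have [|c Kc] := Kst d _ dK.
    by rewrite !inE Hd andbT; apply: contraTneq ltde => ->; rewrite ltnn.
  rewrite in_setU => /orP[/(subsetP (beforeS _ _ _ sH))|].
    by case/andP: bd => _ /eqP ->; rewrite inE.
  rewrite !inE => /andP[/andP[/andP[_ Hc] /eqP rc] ltc]; exists c => //.
  by rewrite !inE Hc rc rde eqxx (ltn_trans ltc ltde) orbT.
move=> no_conf; exists [set e | best e]; split.
- by apply/subsetP=> e; rewrite inE => /andP[].
- by move=> d e; rewrite !inE; apply: bestinj.
- move=> d e; rewrite !inE => bd be rde.
  have := no_conf (d, e); have := no_conf (e, d).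
  rewrite /= bd be rde eqxx /= => /negbT + /negbT; rewrite -!leqNgt => le1 le2.
  case/andP: bd => Hd _; case/andP: be => He _.
  by apply: rr => //; apply/eqP; rewrite eqn_leq le1 le2.
- move=> e He; rewrite inE => ne; have [d bd /andP[ld pd]] := bestP e He.
  exists d; rewrite !inE // ld; case/andP: (bd) => -> _ /=.
  rewrite ltn_neqAle pd andbT; apply/orP; left.
  apply: contraNneq ne => ped.
  have <- // : d = e; apply: rl => //; first by case/andP: bd.
  exact/eqP.
Qed.

(** Galvin's argument: a stable matching [K] among the edges whose lists contain [a] gets color [a],
    which is then deleted from the other lists. An edge that loses [a] this way also loses a
    predecessor in [K], so its list stays long enough. *)
Lemma ranked_list_coloring (C : finType) (pl pr : E -> nat) (H : {set E})
    (L : E -> {set C}) (c0 : C) :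
  ranks l pl H -> ranks r pr H ->
  {in H, forall e, #|before l pl H e| + #|before r pr H e| < #|L e|} ->
  exists2 c : E -> C, {in H, forall e, c e \in L e} &
    {in H &, forall d e, d != e -> (l d == l e) || (r d == r e) -> c d != c e}.
Proof.
have [n] := ubnP #|H|; elim: n => // n IHn in H L * => le_n rl rr szL.
have [->|/set0Pn[e0 He0]] := eqVneq H set0.
  by exists (fun=> c0) => e; rewrite inE.
have [a La] : exists a, a \in L e0.
  by apply/card_gt0P; apply: leq_ltn_trans (szL _ He0).
pose Ha := [set e in H | a \in L e].
have sHa : Ha \subset H by apply/subsetP=> e; rewrite inE => /andP[].
have [K [sK Kl Kr Kst]] := stable_matching (ranksS sHa rl) (ranksS sHa rr).
have sKH := subset_trans sK sHa.
have sH : H :\: K \subset H by apply: subsetDl.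
have K0 : 0 < #|K|.
  have [Ke|eK] := boolP (e0 \in K); first by apply/card_gt0P; exists e0.
  have [|d Kd _] := Kst e0 _ eK; first by rewrite inE He0.
  by apply/card_gt0P; exists d.
have [||||c cL cP] := IHn (H :\: K) (fun e => L e :\ a).
- by rewrite cardsD (setIidPr sKH); have := subset_leq_card sKH; lia.
- exact: ranksS rl.
- exact: ranksS rr.
- move=> e; rewrite inE => /andP[eK He].
  have := szL e He.
  have lel := subset_leq_card (beforeS l pl e sH).
  have ler := subset_leq_card (beforeS r pr e sH).
  rewrite (cardsD1 a (L e)); case: (boolP (a \in L e)) => ae; last by lia.
  suff : #|before l pl (H :\: K) e| + #|before r pr (H :\: K) e| <
         #|before l pl H e| + #|before r pr H e| by lia.
  have [|d Kd] := Kst e _ eK; first by rewrite inE He.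
  rewrite in_setU => /orP[]/(subsetP (beforeS _ _ _ sHa)) bd.
    suff : #|before l pl (H :\: K) e| < #|before l pl H e| by lia.
    apply: proper_card; apply/properP; split; first exact: beforeS.
    by exists d; rewrite // !inE Kd.
  suff : #|before r pr (H :\: K) e| < #|before r pr H e| by lia.
  apply: proper_card; apply/properP; split; first exact: beforeS.
  by exists d; rewrite // !inE Kd.
have cE e : e \in H -> e \notin K -> c e \in L e :\ a.
  by move=> He eK; apply: cL; rewrite inE eK.
exists (fun e => if e \in K then a else c e) => [e He|d e Hd He ne ade].
  case: ifPn => eK; last by have := cE e He eK; rewrite inE => /andP[].
  by have := subsetP sK e eK; rewrite inE => /andP[].
case: ifPn => Kd; case: ifPn => Ke.
- by case/orP: ade ne => /eqP ade; rewrite ?(Kl _ _ Kd Ke ade) ?(Kr _ _ Kd Ke ade) eqxx.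
- by have := cE e He Ke; rewrite !inE eq_sym => /andP[].
- by have := cE d Hd Kd; rewrite !inE => /andP[].
- by apply: cP; rewrite ?inE ?Kd ?Ke.
Qed.

End BipartiteMultigraph.

(** * Ranks for lists as long as the larger end degree (Borodin, Kostochka and Woodall) *)

(* Galvin's condition for lists of size max(d(u), d(w)). *)
Definition good_ranks (E V W : finType) (l : E -> V) (r : E -> W) (H : {set E})
    (pl pr : E -> nat) : Prop :=
  [/\ ranks l pl H, ranks r pr H &
     {in H, forall e, #|before l pl H e| + #|before r pr H e|
                      < maxn #|star l H (l e)| #|star r H (r e)|}].

Lemma good_ranks_swap (E V W : finType) (l : E -> V) (r : E -> W) H pl pr :
  good_ranks l r H pl pr -> good_ranks r l H pr pl.
Proof. by case=> rl rr gH; split=> // e He; rewrite addnC maxnC gH. Qed.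

(* Put each edge of F first at its end in P and last at its other end. An edge
   outside F then loses one place only at an end in P, and this is paid for by
   the drop of the degrees from k to k - 1 at both of its ends. *)
Lemma good_ranks_matching (E V W : finType) (l : E -> V) (r : E -> W) (k : nat)
    (H F : {set E}) (P : {set V}) (ql qr : E -> nat) :
  F \subset H -> {in F &, injective l} -> {in F &, injective r} ->
  l @: F = P -> {in P, forall v, #|star l H v| = k} ->
  (forall w, #|star r H w| <= k) ->
  {in H, forall e, l e \in P -> #|star r H (r e)| = k -> r e \in r @: F} ->
  good_ranks l r (H :\: F) ql qr -> exists pl pr, good_ranks l r H pl pr.
Proof.
move=> sF injl injr defP degP degW covW [rl rr lt_d].
pose top := (\max_e qr e).+1.
have qr_top e : qr e < top by rewrite ltnS leq_bigmax.
pose pl e := if e \in F then 0 else (ql e).+1.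
pose pr e := if e \in F then top else qr e.
have star_lt (U : finType) (f : E -> U) e : e \in F ->
    #|star f (H :\: F) (f e)| < #|star f H (f e)|.
  move=> Fe; apply: proper_card; apply/properP; split; first by rewrite starS ?subsetDl.
  by exists e; rewrite !inE ?Fe ?(subsetP sF) ?eqxx.
have leS (U : finType) (f : E -> U) u : #|star f (H :\: F) u| <= #|star f H u|.
  by rewrite subset_leq_card ?starS ?subsetDl.
exists pl, pr; split.
- move=> d e Hd He lde; rewrite /pl; case: ifPn => Fd; case: ifPn => Fe //.
    by move=> _; apply: injl.
  by case; apply: rl; rewrite ?inE ?Fd ?Fe.
- move=> d e Hd He rde; rewrite /pr; case: ifPn => Fd; case: ifPn => Fe.
  + by move=> _; apply: injr.
  + by move=> eqq; have := qr_top e; rewrite -eqq ltnn.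
  + by move=> eqq; have := qr_top d; rewrite eqq ltnn.
  + by apply: rr; rewrite ?inE ?Fd ?Fe.
move=> e He; have [Fe|eF] := boolP (e \in F).
  have -> : before l pl H e = set0.
    by apply/setP=> d; rewrite !inE /pl Fe ltn0 andbF.
  rewrite cards0 add0n leq_max; apply/orP; right.
  apply: proper_card; apply/properP; split.
    by apply/subsetP=> d; rewrite !inE => /andP[].
  by exists e; rewrite !inE ?He ?eqxx ?ltnn.
have He' : e \in H :\: F by rewrite inE eF.
have -> : before r pr H e = before r qr (H :\: F) e.
  apply/setP=> d; rewrite !inE /pr (negbTE eF); case: (boolP (d \in F)) => Fd //=.
  by rewrite [_ < qr e]ltnNge (ltnW (qr_top e)) andbF.
have sbl : before l pl H e \subset before l ql (H :\: F) e :|: star l F (l e).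
  apply/subsetP=> d; rewrite !inE /pl (negbTE eF).
  by case: (boolP (d \in F)) => Fd /andP[/andP[-> ->]]; rewrite // orbF.
have lebl := leq_trans (subset_leq_card sbl) (leq_card_setU _ _).
have := lt_d e He'; have := leS _ l (l e); have := leS _ r (r e).
have [Pe|nPe] := boolP (l e \in P); last first.
  suff : #|star l F (l e)| = 0 by lia.
  apply: eq_card0 => d; rewrite !inE; apply/negbTE; apply: contra nPe.
  by case/andP=> Fd /eqP <-; rewrite -defP imset_f.
have le1 : #|star l F (l e)| <= 1.
  apply/card_le1_eqP => c d; rewrite !inE => /andP[Fc /eqP lc] /andP[Fd /eqP ld].
  by apply: injl; rewrite // lc.
have : #|star l (H :\: F) (l e)| < k.
  move: (Pe); rewrite -defP => /imsetP[d Fd ->].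
  by rewrite -(degP (l d)) ?star_lt // -defP imset_f.
(* A right end of degree [k] is covered by [F] and loses an edge; any other already has degree below
   [k]. *)
have : #|star r (H :\: F) (r e)| < k.
  have [degk|] := eqVneq #|star r H (r e)| k.
    have /imsetP[d Fd ->] := covW e He Pe degk.
    exact: leq_trans (star_lt _ r d Fd) (degW _).
  by have := degW (r e); have := leS _ r (r e); lia.
by rewrite (degP (l e) Pe); lia.
Qed.

(** Supplies the [F] and [P] for [good_ranks_matching]: a matching that covers a set [P] of left
    vertices of degree [k] and all their neighbors of degree [k]. Such a [P] is a minimal nonempty
    subset of [DV] with at most as many neighbors in [DW] as elements; [DV] itself qualifies. *)
Lemma half_max_matching (E V W : finType) (l : E -> V) (r : E -> W) (k : nat)
    (H : {set E}) (e0 : E) (DV := [set v | #|star l H v| == k])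
    (DW := [set w | #|star r H w| == k]) :
  0 < k -> DV != set0 -> #|DW| <= #|DV| ->
  exists F : {set E}, exists2 P : {set V}, P != set0 &
  [/\ F \subset H, {in F &, injective l}, {in F &, injective r},
    l @: F = P & {in P, forall v, #|star l H v| = k} /\
    {in H, forall e, l e \in P -> #|star r H (r e)| = k -> r e \in r @: F}].
Proof.
move=> k_gt0 DV0 leD.
pose nb v := [set w in DW | [exists e in H, (l e == v) && (r e == w)]].
pose small (Q : {set V}) :=
  [&& Q != set0, Q \subset DV & #|\bigcup_(v in Q) nb v| <= #|Q|].
(* By minimality, either #|N(P)| = #|P| and Hall's condition holds in P, or
   P is a single vertex without neighbors in DW. *)
have [|P /minsetP[/and3P[P0 sP leP] minP] _] := @minset_exists _ small DV.
  rewrite /small DV0 subxx; apply: leq_trans leD; apply: subset_leq_card.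
  by apply/bigcupsP=> v _; apply/subsetP=> w; rewrite inE => /andP[].
have degP : {in P, forall v, #|star l H v| = k}.
  by move=> v /(subsetP sP); rewrite inE => /eqP.
have nbP e : e \in H -> #|star r H (r e)| = k -> r e \in nb (l e).
  move=> He /eqP degk; rewrite !inE degk; apply/existsP; exists e.
  by rewrite He !eqxx.
have [v Pv] := set0Pn _ P0.
move: leP; rewrite leq_eqVlt => /orP[/eqP cardP|ltP].
  have [Q sQ|f injf fnb] := @hall _ _ (r e0) nb P.
    rewrite leqNgt; apply/negP => ltQ.
    have := minP Q; rewrite /small sQ (subset_trans sQ sP) (ltnW ltQ) andbT.
    have -> : Q != set0 by rewrite -card_gt0; apply: leq_ltn_trans ltQ.
    by move=> /(_ isT isT) eQP; move: ltQ; rewrite eQP cardP ltnn.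
  (* The injection is onto by cardinality, so the matching covers every neighbor of [P] in [DW]. *)
  have imf : f @: P = \bigcup_(u in P) nb u.
    apply/eqP; rewrite eqEcard card_in_imset // cardP leqnn andbT.
    by apply/subsetP=> _ /imsetP[u Pu ->]; apply/bigcupP; exists u; rewrite ?fnb.
  pose ed u := odflt e0 [pick e in H | (l e == u) && (r e == f u)].
  have edP u : u \in P -> [/\ ed u \in H, l (ed u) = u & r (ed u) = f u].
    move=> Pu; rewrite /ed; case: pickP => [e /andP[He /andP[/eqP-> /eqP->]] //|no].
    have := fnb u Pu; rewrite inE => /andP[_ /existsP[e He]].
    by have := no e; rewrite /= He.
  exists (ed @: P), P => //; split.
  - by apply/subsetP=> _ /imsetP[u /edP[? _ _] ->].
  - by move=> _ _ /imsetP[u /edP[_ eu _] ->] /imsetP[t /edP[_ et _] ->];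
      rewrite eu et => ->.
  - move=> _ _ /imsetP[u Pu ->] /imsetP[t Pt ->].
    have [_ _ ->] := edP u Pu; have [_ _ ->] := edP t Pt.
    by move/injf => ->.
  - rewrite -imset_comp -[RHS]imset_id; apply: eq_in_imset => u /edP[_ eu _].
    exact: eu.
  - split=> // e He Pe degk; have : r e \in f @: P.
      by rewrite imf; apply/bigcupP; exists (l e); rewrite ?nbP.
    case/imsetP=> u Pu ->; have [_ _ <-] := edP u Pu.
    by apply: imset_f; apply: imset_f.
(* Here [P] has fewer neighbors than elements, so removing [v] keeps the inequality, and minimality
   forces the remainder to be empty. Then [v] has no neighbor in [DW], and any single edge at [v]
   serves as [F]. *)
have PE : P = [set v].
  apply/eqP; rewrite eqEsubset sub1set Pv andbT -setD_eq0.
  apply: contraT => Q0; have := minP (P :\ v).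
  rewrite /small subsetDl Q0 (subset_trans (subsetDl _ _) sP) /=.
  have -> : #|\bigcup_(u in P :\ v) nb u| <= #|P :\ v|.
    rewrite -ltnS -[_ #|P :\ v|]/(1 + _); have := cardsD1 v P; rewrite Pv => <-.
    apply: leq_ltn_trans ltP; apply: subset_leq_card; apply/bigcupsP=> u.
    by rewrite inE => /andP[_ Pu]; apply: bigcup_sup.
  by move=> /(_ isT isT) /setP /(_ v); rewrite !inE eqxx Pv.
have nbv : nb v = set0.
  by move: ltP; rewrite PE big_set1 cards1 ltnS leqn0 cards_eq0 => /eqP.
have [e] : exists e, e \in star l H v by apply/card_gt0P; rewrite degP.
rewrite inE => /andP[He /eqP le].
exists [set e], P => //; split.
- by rewrite sub1set.
- by move=> ? ? /set1P-> /set1P->.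
- by move=> ? ? /set1P-> /set1P->.
- by rewrite imset_set1 le PE.
- split=> // d Hd; rewrite PE => /set1P ld degk.
  by have := nbP d Hd degk; rewrite ld nbv inE.
Qed.

(** Induction on the number of edges. With [k] the maximum degree, the side with at least as many
    vertices of degree [k] yields a nonempty matching [F], and ranks for the rest extend over [F].
    The induction generalizes the end maps because the sides may be swapped. *)
Lemma good_ranks_exist (E V W : finType) (l : E -> V) (r : E -> W) (H : {set E}) :
  exists pl pr, good_ranks l r H pl pr.
Proof.
have [n] := ubnP #|H|; elim: n => // n IHn in V W l r H *; rewrite ltnS => le_n.
have [->|/set0Pn[e0 He0]] := eqVneq H set0.
  by exists (fun=> 0), (fun=> 0); split=> ?; rewrite inE.
pose kV := \max_v #|star l H v|; pose kW := \max_w #|star r H w|.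
pose k := maxn kV kW.
have degV v : #|star l H v| <= k.
  by rewrite leq_max (leq_bigmax (F := fun v => #|star l H v|)).
have degW w : #|star r H w| <= k.
  by rewrite leq_max orbC (leq_bigmax (F := fun w => #|star r H w|)).
have k_gt0 : 0 < k.
  by apply: leq_trans (degV (l e0)); apply/card_gt0P; exists e0; rewrite inE He0 /=.
pose DV := [set v | #|star l H v| == k]; pose DW := [set w | #|star r H w| == k].
have D0 : (DV != set0) || (DW != set0).
  rewrite -negb_and; apply/negP => /andP[/eqP DV0 /eqP DW0].
  have ltV : kV < k.
    rewrite -(prednK k_gt0) ltnS; apply/bigmax_leqP => v _.
    by have := degV v; move/setP/(_ v): DV0; rewrite !inE => /negbT; lia.
  have ltW : kW < k.
    rewrite -(prednK k_gt0) ltnS; apply/bigmax_leqP => w _.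
    by have := degW w; move/setP/(_ w): DW0; rewrite !inE => /negbT; lia.
  by move: ltV ltW; rewrite /k; lia.
have lt_n (F : {set E}) : F \subset H -> F != set0 -> #|H :\: F| < n.
  move=> sF; rewrite -card_gt0 cardsD (setIidPr sF).
  by have := subset_leq_card sF; lia.
have F0 (U : finType) (f : E -> U) (F : {set E}) (P : {set U}) : P != set0 -> f @: F = P -> F != set0.
  by move=> P0 defP; apply: contra_neq P0 => F0; rewrite -defP F0 imset0.
case: (leqP #|DW| #|DV|) => leD.
  have DV0 : DV != set0.
    by move: D0 leD; rewrite -!card_gt0; lia.
  have [F [P P0 [sF injl injr defP [degP cov]]]] :=
    half_max_matching e0 k_gt0 DV0 leD.
  have [ql [qr gq]] := IHn _ _ l r _ (lt_n _ sF (F0 _ _ _ _ P0 defP)).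
  exact: good_ranks_matching defP degP degW cov gq.
have DW0 : DW != set0 by move: D0 leD; rewrite -!card_gt0; lia.
have [F [P P0 [sF injr injl defP [degP cov]]]] :=
  half_max_matching e0 k_gt0 DW0 (ltnW leD).
have [qr [ql gq]] := IHn _ _ r l _ (lt_n _ sF (F0 _ _ _ _ P0 defP)).
have [pr [pl gp]] := good_ranks_matching sF injr injl defP degP degV cov gq.
by exists pl, pr; apply: good_ranks_swap.
Qed.

(** The theorem of Borodin, Kostochka and Woodall: Galvin's argument run with good ranks. *)
Lemma list_edge_coloring (E V W C : finType) (l : E -> V) (r : E -> W) (H : {set E})
    (L : E -> {set C}) (c0 : C) :
  {in H, forall e, maxn #|star l H (l e)| #|star r H (r e)| <= #|L e|} ->
  exists2 c : E -> C, {in H, forall e, c e \in L e} &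
    {in H &, forall d e, d != e -> (l d == l e) || (r d == r e) -> c d != c e}.
Proof.
move=> szL; have [pl [pr [rl rr lt_d]]] := good_ranks_exist l r H.
apply: (ranked_list_coloring c0 rl rr) => e He.
exact: leq_trans (lt_d e He) (szL e He).
Qed.

(** * Distances, edges and colorings given on adjacent pairs *)

Lemma dist_geq_mindist k a b :
  dist_geq k (mindist a b) = dist_geq k a && dist_geq k b.
Proof. by case: a b => [d|] [e|]; rewrite //= ?andbT // leq_min. Qed.

Lemma dist_geq_edge_dist (G : sgraph) k (e f : {set G}) :
  dist_geq k (edge_dist e f) =
  [forall x in e, forall y in f, dist_geq k (dist x y)].
Proof.
rewrite /edge_dist (big_morph (dist_geq k) (dist_geq_mindist k) (erefl : dist_geq k None = true)).
rewrite big_andE; apply: eq_forallb_in => x _.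
by rewrite (big_morph (dist_geq k) (dist_geq_mindist k) (erefl : dist_geq k None = true)) big_andE.
Qed.

Lemma dist_geq2_nonadj (G : sgraph) (x y : G) :
  dist_geq 2 (dist x y) -> ~~ ((x == y) || adj x y).
Proof.
have := distP x y; case: (dist x y) => [d [_ dmin]|no_walk] /= ge2;
    apply/negP => /orP[/eqP xy|xy].
- have /dmin : walk 0 x y by apply/walkP; exists [::].
  by lia.
- have /dmin : walk 1 x y by apply/walkP; exists [:: y]; rewrite /= xy.
  by lia.
- by have /walkP[] := no_walk 0; exists [::].
- by have /walkP[] := no_walk 1; exists [:: y]; rewrite /= xy.
Qed.

Lemma edgesP (G : sgraph) (e : {set G}) :
  reflect (exists x y, adj x y /\ e = [set x; y]) (e \in edges G).
Proof.
apply: (iffP imsetP) => [[p xy ->]|[x [y [xy ->]]]]; first by exists p.1, p.2.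
by exists (x, y).
Qed.

Lemma edge_at (G : sgraph) (e : {set G}) (x : G) :
  e \in edges G -> x \in e -> exists2 y, adj x y & e = [set x; y].
Proof.
case/edgesP=> u [v [uv ->]] /set2P[] ->; first by exists v.
by exists u; rewrite 1?adj_sym // setUC.
Qed.

Lemma set2_inj (T : finType) (x y z : T) : [set x; y] = [set x; z] -> y = z.
Proof.
move=> eqs; have /set2P[yx|//] : y \in [set x; z] by rewrite -eqs set22.
have: z \in [set x; y] by rewrite eqs set22.
by case/set2P=> ->.
Qed.

(** Colorings are easier to define on ordered pairs; symmetry of [k] makes the order chosen for the
    two ends harmless. *)
Lemma edge_coloring_of_adj (G : sgraph) (k : G -> G -> nat) :
  (forall x y, adj x y -> k x y = k y x) ->
  (forall x y z, adj x y -> adj x z -> y != z -> k x y != k x z) ->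
  exists2 c : {set G} -> nat, proper_edge_coloring c &
    forall x y, adj x y -> c [set x; y] = k x y.
Proof.
move=> ksym kP.
pose c (e : {set G}) :=
  if [pick p : G * G | adj p.1 p.2 && (e == [set p.1; p.2])] is Some p
  then k p.1 p.2 else 0.
have cE x y : adj x y -> c [set x; y] = k x y.
  move=> xy; rewrite /c; case: pickP => [[u v] /= /andP[uv /eqP eqs]|].
    have : x \in [set u; v] by rewrite -eqs set21.
    case/set2P=> xE; rewrite xE in eqs *; first by rewrite (set2_inj eqs).
    by rewrite ksym // [RHS]setUC in eqs *; rewrite (set2_inj eqs).
  by move/(_ (x, y)); rewrite /= xy eqxx.
exists c => //; apply/forall_inP=> e He; apply/forall_inP=> f Hf.
apply/implyP=> /andP[ne /set0Pn[x]]; rewrite inE => /andP[xe xf].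
have [y xy eE] := edge_at He xe; have [z xz fE] := edge_at Hf xf.
rewrite eE fE !cE // kP //; apply: contra_neq ne => yz.
by rewrite eE fE yz.
Qed.

(** * Degree bounds for the chromatic index *)

Lemma degree_le_colors (G : sgraph) (c : {set G} -> nat) k (x : G) :
  proper_edge_coloring c -> colors_within k c -> #|[set y | adj x y]| <= k.
Proof.
move=> /forall_inP cP /forall_inP cK.
have edge y : adj x y -> [set x; y] \in edges G by move=> xy; apply/edgesP; exists x, y.
pose f y : 'I_k.+1 := inord (c [set x; y]).
have fE y : adj x y -> f y = c [set x; y] :> nat.
  by move=> xy; rewrite /f inordK // ltnS; case/andP: (cK _ (edge y xy)).
have injf : {in [set y | adj x y] &, injective f}.
  move=> y z; rewrite !inE => xy xz /(congr1 val); rewrite /= !fE // => eqc.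
  apply/eqP; apply: contraT => ne.
  have /forall_inP := cP _ (edge y xy); move=> /(_ _ (edge z xz)).
  rewrite eqc eqxx implybF negb_and negbK => /orP[/eqP/set2_inj yz|].
    by rewrite yz eqxx in ne.
  by move/negP; case; apply/set0Pn; exists x; rewrite inE !set21.
(* Colors start at 1, so 0 is missed and only [k] of the [k.+1] ordinals remain. *)
rewrite -(card_in_imset injf); apply: leq_trans (_ : #|[set~ (ord0 : 'I_k.+1)]| <= _).
  apply: subset_leq_card; apply/subsetP=> _ /imsetP[y + ->]; rewrite !inE => xy.
  apply: contraTneq (cK _ (edge y xy)) => /(congr1 val); rewrite /= fE // => ->.
  by rewrite ltnn.
by rewrite cardsC1 card_ord.
Qed.

Lemma degree_le_chromatic_index (G : sgraph) (x : G) :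
  #|[set y | adj x y]| <= chromatic_index G.
Proof.
rewrite /chromatic_index; case: ex_minnP => k /edge_colorableP[c /andP[cP cK]] _.
exact: degree_le_colors cP cK.
Qed.

Lemma num_colors_within (G : sgraph) (c : {set G} -> nat) k :
  colors_within k c -> num_colors c <= k.
Proof.
move=> /forall_inP cK; rewrite /num_colors -(size_iota 1 k).
apply: uniq_leq_size (undup_uniq _) _ => a.
rewrite mem_undup => /imageP[e He ->]; rewrite mem_iota add1n ltnS.
exact: cK.
Qed.

Lemma degree_cartesian_complete (G : sgraph) n (u : cartesian_product G (complete_graph n)) :
  #|[set x | adj u.1 x]| + n.-1 <= #|[set v | adj u v]|.
Proof.
case: u => x i /=.
pose X := [set (y, i) | y in [set y | adj x y]].
pose Y := [set (x, j) | j in [set~ i]].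
have XY : [disjoint X & Y].
  rewrite disjoints_subset; apply/subsetP=> _ /imsetP[y xy ->]; rewrite inE.
  apply/negP=> /imsetP[j _ [yx _]]; move: xy; rewrite inE yx.
  by have -> := adj_irrefl x.
have <- : #|X :|: Y| = #|[set y | adj x y]| + n.-1.
  move: XY; rewrite -leq_card_setU => /eqP ->.
  by rewrite !card_imset ?cardsC1 ?card_ord // => y z [].
apply: subset_leq_card; apply/subsetP=> v; rewrite in_setU.
case/orP=> /imsetP[y]; rewrite !inE => xy ->; rewrite /adj /= /cart_rel /=.
  by rewrite eqxx; apply/orP; right.
by rewrite eqxx /= /complete_rel eq_sym xy.
Qed.

(** * Factorizations of a complete graph of even order and renaming of their colors *)

Lemma one_factorization m : 0 < m ->
  exists g : 'I_(2 * m) -> 'I_(2 * m) -> 'I_(2 * m - 1),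
    (forall i j, g i j = g j i) /\
    (forall i j k, i != j -> i != k -> g i j = g i k -> j = k).
Proof.
move=> m_gt0; pose n := 2 * m - 1; have n_gt0 : 0 < n by rewrite /n; lia.
(* Round-robin tournament: color i + j mod n, and 2i mod n for the extra vertex n. *)
pose s (i j : nat) := if i == n then j + j else if j == n then i + i else i + j.
exists (fun i j => Ordinal (ltn_pmod (s i j) n_gt0)); split=> [i j|i j k ij ik].
  apply: val_inj => /=; rewrite /s addnC; have [->|] := eqVneq (i : nat) n.
    by case: eqVneq => [->|].
  by case: eqVneq => // _; rewrite addnC.
have lt (t : 'I_(2 * m)) : t != n :> nat -> t < n.
  by move=> tn; have := ltn_ord t; rewrite /n in tn *; lia.
(* As [n] is odd, doubling is injective modulo [n], which separates the edges at the extra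
   vertex. *)
have odd_n : coprime n 2.
  by rewrite coprimen2 oddB ?muln_gt0 ?m_gt0 // mul2n odd_double.
have canc (a b c : nat) : b < n -> c < n -> (a + b) %% n = (a + c) %% n -> b = c.
  by move=> bn cn /eqP; rewrite eqn_modDl !modn_small // => /eqP.
move=> /(congr1 val) /=; rewrite /s => eqs; apply: val_inj; move: eqs ij ik.
rewrite -!val_eqE /=; have [->|/lt ltin] := eqVneq (i : nat) n.
  rewrite ![n == _]eq_sym => eqs /lt ltjn /lt ltkn.
  have : (j * 2 == k * 2 %[mod n]) by rewrite !muln2 -!addnn eqs.
  wlog lejk : j k ltjn ltkn {eqs} / k <= j => [IH|].
    case: (leqP k j) => [|/ltnW] le; first exact: IH.
    by rewrite eq_sym => /(IH k j ltkn ltjn le) ->.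
  rewrite eqn_mod_dvd ?leq_mul2r ?lejk ?orbT // -mulnBl Gauss_dvdl //.
  rewrite -eqn_mod_dvd // !modn_small // => /eqP //.
(* At [i] other than [n], the edge to [n] has the color [i + i] that a loop at [i] would have, so it
   differs from every [i + k]. *)
have [->|/lt ltjn] := eqVneq (j : nat) n; have [->|/lt ltkn] := eqVneq (k : nat) n => //.
- by move=> /(canc _ _ _ ltin ltkn) -> _; rewrite eqxx.
- by move=> /(canc _ _ _ ltjn ltin) ->; rewrite eqxx.
- by move=> /(canc _ _ _ ltjn ltkn).
Qed.

(** An arbitrary injection into [B] is composed with the transposition of its value at [t] and [c].
    With [t] the factor containing a precolored vertical edge, this gives that edge its color. *)
Lemma inj_into_through (n : nat) (C : finType) (B : {set C}) (t : 'I_n) (c : C) :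
  n <= #|B| -> c \in B ->
  exists s : 'I_n -> C, [/\ injective s, forall i, s i \in B & s t = c].
Proof.
move=> leB cB; pose s0 (i : 'I_n) : C := enum_val (widen_ord leB i).
have s0B i : s0 i \in B by apply: enum_valP.
pose swap x := if x == s0 t then c else if x == c then s0 t else x.
have swapK : involutive swap.
  move=> x; rewrite /swap; have [->|xt] := eqVneq x (s0 t).
    by case: eqVneq => [->|]; rewrite ?eqxx.
  by have [->|xc] := eqVneq x c; rewrite ?eqxx // (negbTE xt) (negbTE xc).
exists (swap \o s0); split=> [i j /= /(can_inj swapK)|i|].
- by move=> /enum_val_inj /(congr1 val) /= /val_inj.
- by rewrite /= /swap; case: ifP => // _; case: ifP.
- by rewrite /= /swap eqxx.
Qed.

(** * The common coloring of the levels *)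

Lemma degree_le_max (G : sgraph) (x : G) : #|[set y | adj x y]| <= max_degree G.
Proof.
by rewrite /max_degree; apply: (@leq_bigmax _ (fun x : G => #|[set y | adj x y]|)).
Qed.

(* hz is the projection to G of the horizontal precolored edges, and cl x the
   color prescribed in the layer of x. *)
Lemma level_coloring (G : sgraph) (N m : nat) (cl : G -> option 'I_N.+1) (hz : rel G) :
  bipartite G -> 0 < m -> N.+1 = max_degree G + 2 * m - 1 ->
  symmetric hz -> (forall x y, hz x y -> adj x y) ->
  (forall x y z, hz x y -> hz x z -> y = z) ->
  (forall x y, hz x y -> cl x = cl y /\ cl x) ->
  (forall x y, m = 1 -> adj x y -> cl x -> cl y -> exists z, hz x z) ->
  exists h : G -> G -> 'I_N.+1,
  [/\ forall x y, adj x y -> h x y = h y x,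
      forall x y z, adj x y -> adj x z -> y != z -> h x y != h x z,
      forall x y, hz x y -> cl x = Some (h x y) &
      forall x y, adj x y -> ~~ hz x y -> cl x != Some (h x y)].
Proof.
case=> A AP m_gt0 NE hz_sym hz_adj hz_inj hz_cl hz_m1.
(* Each edge outside [hz] is listed once, with its end in [A] first, so [fst] and [snd] are the end
   maps of a bipartite graph. *)
pose H := [set p : G * G | [&& p.1 \in A, adj p.1 p.2 & ~~ hz p.1 p.2]].
pose X x := [set c | cl x == Some c].
pose L (p : G * G) := ~: (X p.1 :|: X p.2).
have cardX x : #|X x| <= (cl x : bool).
  case clx: (cl x) => [a|] /=.
    rewrite -(cards1 a); apply: subset_leq_card; apply/subsetP=> c.
    by rewrite !inE clx => /eqP[->].
  by rewrite leqn0 cards_eq0; apply/eqP/setP=> c; rewrite !inE clx.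
have deg := @degree_le_max G.
pose nb x := [set y | adj x y && ~~ hz x y].
have nb_le x : #|nb x| <= max_degree G.
  apply: leq_trans (deg x); apply: subset_leq_card; apply/subsetP=> y.
  by rewrite !inE => /andP[].
have nb_lt x z : hz x z -> #|nb x| < max_degree G.
  move=> xz; apply: leq_trans (deg x); apply: proper_card; apply/properP; split.
    by apply/subsetP=> y; rewrite !inE => /andP[].
  by exists z; rewrite !inE ?xz ?andbF ?hz_adj.
have starl x : #|star fst H x| <= #|nb x|.
  rewrite -(card_in_imset (f := @snd G G)); last first.
    by move=> [u v] [u' v']; rewrite !inE /= => /andP[_ /eqP->] /andP[_ /eqP->] ->.
  apply: subset_leq_card; apply/subsetP=> _ /imsetP[p + ->]; rewrite !inE.
  by case/andP=> /and3P[_ ? ?] /eqP <-; apply/andP.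
have starr x : #|star snd H x| <= #|nb x|.
  rewrite -(card_in_imset (f := @fst G G)); last first.
    by move=> [u v] [u' v']; rewrite !inE /= => /andP[_ /eqP->] /andP[_ /eqP->] ->.
  apply: subset_leq_card; apply/subsetP=> _ /imsetP[p + ->]; rewrite !inE.
  by case/andP=> /and3P[_ ? ?] /eqP <-; rewrite adj_sym hz_sym; apply/andP.
have [p|c cL cP] := @list_edge_coloring _ _ _ _ (@fst G G) (@snd G G) H L ord0.
  rewrite inE => /and3P[_ padj _]; rewrite geq_max.
  suff: (#|nb p.1| <= #|L p|) && (#|nb p.2| <= #|L p|).
    by case/andP=> ? ?; rewrite (leq_trans (starl _)) ?(leq_trans (starr _)).
  have: N.+1 <= #|L p| + (cl p.1 : bool) + (cl p.2 : bool).
    have := cardsC (X p.1 :|: X p.2); rewrite card_ord -/(L p).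
    have := (leq_card_setU (X p.1) (X p.2)).1.
    by have := cardX p.1; have := cardX p.2; lia.
  have := nb_le p.1; have := nb_le p.2.
  (* For [m > 1] the palette exceeds the maximum degree by at least 3, which absorbs two forbidden
     colors. For [m = 1] the surplus is 1, and a second forbidden color is paid for by the smaller
     degrees at both ends. *)
  have [m1|m1] := eqVneq m 1; last first.
    by case: (cl p.1 : bool) (cl p.2 : bool) => [] []; lia.
  case cl1: (isSome (cl p.1)); last by case: (cl p.2 : bool); lia.
  case cl2: (isSome (cl p.2)); last by lia.
  have [z /nb_lt] := hz_m1 _ _ m1 padj cl1 cl2.
  have [t /nb_lt] : exists t, hz p.2 t by apply: (hz_m1 _ p.1) => //; rewrite adj_sym.
  by lia.
(* The default [ord0] is not reached, since [hz_cl] makes [cl x] defined whenever [hz x y] holds. *)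
pose h x y :=
  if hz x y then odflt ord0 (cl x) else if x \in A then c (x, y) else c (y, x).
have hL x y : adj x y -> ~~ hz x y -> cl x != Some (h x y).
  move=> xy nxy; rewrite /h (negbTE nxy); case: ifPn => xA.
    by have := cL (x, y); rewrite !inE xA xy nxy => /(_ isT) /norP[].
  have yA : y \in A by have := AP _ _ xy; rewrite (negbTE xA); case: (y \in A).
  have := cL (y, x); rewrite !inE yA adj_sym xy hz_sym nxy => /(_ isT).
  by case/norP.
have hhz x y : hz x y -> cl x = Some (h x y).
  by move=> xy; rewrite /h xy; have [_] := hz_cl _ _ xy; case: (cl x).
exists h; split=> // [x y xy|x y z xy xz yz].
  rewrite /h hz_sym; case: ifPn => [yx|_]; first by have [->] := hz_cl _ _ yx.
  by have := AP _ _ xy; case: (x \in A) (y \in A) => [] [].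
have [hxy|hxy] := boolP (hz x y); have [hxz|hxz] := boolP (hz x z).
- by rewrite (hz_inj _ _ _ hxy hxz) eqxx in yz.
- by have := hL _ _ xz hxz; rewrite (hhz _ _ hxy).
- by have := hL _ _ xy hxy; rewrite (hhz _ _ hxz) eq_sym.
rewrite /h (negbTE hxy) (negbTE hxz); case: ifPn => xA.
  by apply: cP; rewrite ?inE ?xA ?xy ?xz //= ?eqxx // xpair_eqE eqxx.
have [/negbTE yA /negbTE zA] : ~~ (y \notin A) /\ ~~ (z \notin A).
  by have := AP _ _ xy; have := AP _ _ xz; rewrite (negbTE xA);
    case: (y \in A) (z \in A) => [] [].
apply: cP; rewrite ?inE /= ?eqxx ?orbT ?xpair_eqE ?(negbTE yz) //.
  by rewrite adj_sym xy hz_sym hxy; move/negbFE: yA => ->.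
by rewrite adj_sym xz hz_sym hxz; move/negbFE: zA => ->.
Qed.

(** * Assembly of the coloring of the product *)

Theorem theorem2 (G : sgraph) (m : nat)
  (M : {set {set cartesian_product G (complete_graph (2 * m))}})
  (phi : {set cartesian_product G (complete_graph (2 * m))} -> nat) :
  bipartite G ->
  1 <= m ->
  M \subset edges (cartesian_product G (complete_graph (2 * m))) ->
  (forall e f, e \in M -> f \in M -> e != f -> dist_geq 2 (edge_dist e f)) ->
  (forall e, e \in M -> 1 <= phi e <= max_degree G + 2 * m - 1) ->
  extendable M phi /\
  exists c : {set cartesian_product G (complete_graph (2 * m))} -> nat,
    [/\ proper_edge_coloring c,
        num_colors c <=
          chromatic_index (cartesian_product G (complete_graph (2 * m))),
        colors_within (max_degree G + 2 * m - 1) c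
      & extends M phi c].
Proof.
set K := complete_graph (2 * m); set GK := cartesian_product G K.
move=> bipG m_gt0 sM distM phiM.
(* Staying within the palette suffices: if there is an edge, a vertex of the product has degree at
   least the palette size, which is thus at most the chromatic index; with no edges no color is
   counted. *)
suff [c [cP cK cM]] : exists c : {set GK} -> nat,
    [/\ proper_edge_coloring c, colors_within (max_degree G + 2 * m - 1) c
      & extends M phi c].
  have cX : num_colors c <= chromatic_index GK.
    have [no_edge|/set0Pn[e /edgesP[u [_ _]]]] := eqVneq (edges GK) set0.
      by apply: leq_trans (size_undup _) _; rewrite size_image no_edge cards0.
    apply: leq_trans (num_colors_within cK) _.
    have [|x degx] := @eq_bigmax G (fun x => #|[set y | adj x y]|).
      by apply/card_gt0P; exists u.1.
    apply: leq_trans (degree_le_chromatic_index ((x, u.2) : GK)).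
    by rewrite /max_degree degx -addnBA ?muln_gt0 ?m_gt0 // subn1;
      exact: (@degree_cartesian_complete G (2 * m) (x, u.2)).
  by split; exists c.
(* Colors become ordinals below [N.+1], shifted down by one; hence [.-1] in [col] and [.+1] in
   [k]. *)
have [N NE] : exists N, N.+1 = max_degree G + 2 * m - 1.
  by exists (max_degree G + 2 * m - 2); lia.
have sepM e f (u v : GK) : e \in M -> f \in M -> u \in e -> v \in f ->
    (u == v) || adj u v -> e = f.
  move=> Me Mf ue vf uv; apply/eqP; apply: contraT => /(distM _ _ Me Mf).
  rewrite dist_geq_edge_dist => /forall_inP/(_ u ue)/forall_inP/(_ v vf).
  by move/dist_geq2_nonadj; rewrite uv.
pose touch (e : {set GK}) x := [exists i, (x, i) \in e].
have touch_inj e f x : e \in M -> f \in M -> touch e x -> touch f x -> e = f.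
  move=> Me Mf /existsP[i xe] /existsP[j xf]; apply: sepM xe xf _ => //.
  rewrite /adj /= /cart_rel /= /complete_rel xpair_eqE !eqxx /=.
  by case: eqVneq.
pose col e : 'I_N.+1 := inord (phi e).-1.
have colE e : e \in M -> (col e).+1 = phi e.
  by move=> /phiM; rewrite -NE /col => ?; rewrite inordK; lia.
pose cl x := omap col [pick e in M | touch e x].
have clE e x : e \in M -> touch e x -> cl x = Some (col e).
  move=> Me xe; rewrite /cl; case: pickP => [f /andP[Mf xf]|/(_ e)].
    by rewrite (touch_inj _ _ _ Me Mf xe xf).
  by rewrite /= Me xe.
have clP x : cl x -> exists2 e, e \in M & touch e x.
  by rewrite /cl; case: pickP => // e /andP[Me xe]; exists e.
pose hz x y := adj x y && [exists i, [set ((x, i) : GK); ((y, i) : GK)] \in M].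
have hzP x y : hz x y -> exists e, [/\ e \in M, touch e x, touch e y &
    exists i, e = [set ((x, i) : GK); ((y, i) : GK)]].
  case/andP=> _ /existsP[i Me]; eexists; split; first exact: Me; last by exists i.
    by apply/existsP; exists i; rewrite set21.
  by apply/existsP; exists i; rewrite set22.
have [|||||h [hsym hP hhz hnhz]] := @level_coloring G N m cl hz bipG m_gt0 NE.
- move=> x y; rewrite /hz adj_sym; congr (_ && _).
  by apply: eq_existsb => i; rewrite setUC.
- by move=> x y /andP[].
- move=> x y z xy xz; have [e [Me xe _ [i eE]]] := hzP _ _ xy.
  have [f [Mf xf _ [j fE]]] := hzP _ _ xz.
  have := touch_inj _ _ _ Me Mf xe xf; rewrite eE fE => eqs.
  have : ((y, i) : GK) \in [set ((x, j) : GK); ((z, j) : GK)] by rewrite -eqs set22.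
  case/set2P=> -[] // yx _; case/andP: xy; rewrite yx.
  by have -> := adj_irrefl x.
- by move=> x y /hzP[e [Me xe ye _]]; rewrite (clE e x) ?(clE e y).
- move=> x y m1 xy /clP[e Me xe] /clP[f Mf /existsP[j yf]].
  case/existsP: xe => i xe; have [[z i'] /orP[]] := edge_at (subsetP sM e Me) xe.
    move=> /andP[/= /eqP <- /eqP ne_ii'] eE.
    (* With two levels only, a vertical edge at [x] also meets level [j], where it is adjacent to
       the end [(y, j)] of [f]; so [e] must be horizontal. *)
    have xje : ((x, j) : GK) \in e.
      suff : (j == i) || (j == i').
        by rewrite eE => /orP[/eqP->|/eqP->]; rewrite ?set21 ?set22.
      rewrite -!val_eqE /=; move: ne_ii' (ltn_ord i) (ltn_ord i') (ltn_ord j).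
      by move/eqP; rewrite -val_eqE /=; lia.
    have fe : e = f.
      by apply: sepM xje yf _ => //; rewrite /adj /= /cart_rel /= xy eqxx !orbT.
    move: yf; rewrite -fe eE => /set2P[] [yx _]; move: xy; rewrite yx;
      by have -> := adj_irrefl x.
  move=> /andP[/= /eqP <- xz] eE; exists z; rewrite /hz xz; apply/existsP; exists i.
  by rewrite -eE.
have [g [gsym gP]] := one_factorization m_gt0.
pose B x := ~: [set h x y | y in [set y | adj x y]].
have cardB x : 2 * m - 1 <= #|B x|.
  rewrite cardsCs setCK card_ord.
  apply: leq_trans (leq_sub2l _ (leq_trans (leq_imset_card _ _) (degree_le_max x))).
  by lia.
(* [S x] renames the factors by colors that [h] misses at [x], subject to the vertical edge of [M]
   at [x], if there is one. *)
have [S SP] : exists S : G -> 'I_(2 * m - 1) -> 'I_N.+1, forall x,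
    [/\ injective (S x), forall t, S x t \in B x &
      forall i j, i != j -> [set ((x, i) : GK); ((x, j) : GK)] \in M ->
        cl x = Some (S x (g i j))].
  pose spec x s := [/\ injective s, forall t, s t \in B x &
    forall i j, i != j -> [set ((x, i) : GK); ((x, j) : GK)] \in M ->
      cl x = Some (s (g i j))].
  apply: (@fin_all_exists _ _ spec) => x.
  case: (pickP (fun ij : 'I_(2 * m) * 'I_(2 * m) => (ij.1 != ij.2) &&
      ([set ((x, ij.1) : GK); ((x, ij.2) : GK)] \in M))) => [[i j]|no_vert].
    set e := [set _; _] => /andP[/= ij Me].
    have xe : touch e x by apply/existsP; exists i; rewrite set21.
    (* Edges of [G] outside [hz] avoid the color of the layer, and an [hz] edge at [x] would come
       from [e] itself, which is vertical. *)
    have Bc : col e \in B x.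
      rewrite inE; apply/negP=> /imsetP[y]; rewrite inE => xy colh.
      have [xy_hz|/(hnhz _ _ xy)] := boolP (hz x y); last first.
        by rewrite (clE _ _ Me xe) colh eqxx.
      have [f [Mf xf /existsP[k yf] _]] := hzP _ _ xy_hz.
      move: yf; rewrite -(touch_inj _ _ _ Me Mf xe xf) => /set2P[] [yx _].
        by move: xy; rewrite yx; have -> := adj_irrefl x.
      by move: xy; rewrite yx; have -> := adj_irrefl x.
    have [s [injs sB sg]] := inj_into_through (g i j) (cardB x) Bc.
    exists s; split=> // i' j' ij' Me'; rewrite (clE _ _ Me xe) -sg.
    have xe' : touch [set ((x, i') : GK); ((x, j') : GK)] x.
      by apply/existsP; exists i'; rewrite set21.
    have eqs := touch_inj _ _ _ Me Me' xe xe'.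
    have : ((x, i') : GK) \in e by rewrite eqs set21.
    have : ((x, j') : GK) \in e by rewrite eqs set22.
    move=> /set2P[] [ej] /set2P[] [ei]; rewrite ei ej ?eqxx // in ij' *.
    by rewrite gsym.
  have n_gt0 : 0 < 2 * m - 1 by lia.
  have [c cB] : exists c, c \in B x by apply/card_gt0P; apply: leq_trans (cardB x).
  have [s [injs sB _]] := inj_into_through (Ordinal n_gt0) (cardB x) cB.
  by exists s; split=> // i j ij Me; have := no_vert (i, j); rewrite /= ij Me.
pose k (u v : GK) : nat := (if u.1 == v.1 then S u.1 (g u.2 v.2) else h u.1 v.1).+1.
have adjP (u v : GK) : adj u v ->
    u.1 = v.1 /\ u.2 != v.2 \/ [/\ u.1 != v.1, u.2 = v.2 & adj u.1 v.1].
  case/orP=> /andP[/eqP eq1 ad]; [by left|right; split=> //].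
  by apply: contraTneq ad => ->; rewrite adj_irrefl.
have [u v uv|u v w uv uw vw|c cP cE] := @edge_coloring_of_adj GK k.
- rewrite /k; case: (adjP _ _ uv) => [[-> _]|[ne _ ad]].
    by rewrite !eqxx gsym.
  by rewrite [_ == u.1]eq_sym (negbTE ne) hsym.
- rewrite /k eqSS; have SNh t y : adj u.1 y -> S u.1 t != h u.1 y.
    move=> uy; have [_ /(_ t) + _] := SP u.1; rewrite inE; apply: contraNneq => ->.
    by rewrite imset_f // inE.
  case: (adjP _ _ uv) => [[uv1 uv2]|[/negbTE uv1 uv2 adv]];
    case: (adjP _ _ uw) => [[uw1 uw2]|[/negbTE uw1 uw2 adw]].
  + rewrite -uv1 -uw1 eqxx; have [injS _ _] := SP u.1.
    apply: contra_neq vw => /val_inj/injS/(gP _ _ _ uv2 uw2).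
    by case: v w uv1 uw1 {uv uw uv2 uw2} => [v1 v2] [w1 w2] /= <- <- ->.
  + by rewrite -uv1 eqxx uw1 SNh.
  + by rewrite -uw1 eqxx uv1 eq_sym SNh.
  + rewrite uv1 uw1 hP //; apply: contra_neq vw => eq1.
    by case: v w uv2 uw2 eq1 {uv uw uv1 uw1 adv adw} => [? ?] [? ?] /= <- <- ->.
exists c; split=> //.
  apply/forall_inP=> e /edgesP[u [v [uv ->]]]; rewrite cE // -NE /k ltnS.
  by case: ifP => _; apply: ltn_ord.
move=> e Me; have /edgesP[u [v [uv eE]]] := subsetP sM e Me.
rewrite eE cE // -eE -colE // /k; congr (nat_of_ord _).+1; apply: Some_inj.
have ue : touch e u.1 by apply/existsP; exists u.2; rewrite eE -surjective_pairing set21.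
rewrite -(clE _ _ Me ue); case: (adjP _ _ uv) => [[uv1 uv2]|[/negbTE uv1 uv2 ad]].
  rewrite uv1 eqxx -uv1; have [_ _ /(_ _ _ uv2) ->] // := SP u.1.
  by rewrite {2}uv1 -!surjective_pairing -eE.
rewrite uv1 (hhz _ v.1) // /hz ad; apply/existsP; exists u.2.
by rewrite {2}uv2 -!surjective_pairing -eE.
Qed.
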